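(* Let $G$ be a graph of order $n\ge 2$. Then $\operatorname{th}_+(G)=2$ if and only if $G=K_{1,n-1}$ or $G=2K_1$ (up to isomorphism).
   Context: All graphs are finite, simple and undirected. $K_{1,n-1}$ is the star on $n$ vertices (complete bipartite graph), and $2K_1$ is the graph consisting of two isolated vertices. Positive semidefinite (PSD) color change rule: each vertex of $G$ is blue or white; let $B$ be the current set of blue vertices and let $W_1,\dots,W_k$ be the vertex sets of the connected components of $G-B$. A white vertex $w\in W_i$ is colored blue (is forced by the blue vertex $v$) when $w$ is the only white neighbor of $v$ in the induced subgraph $G[W_i\cup B]$. Starting with exactly the vertices of $S\subseteq V(G)$ blue, at each time step all possible forces are performed simultaneously. $S$ is a PSD zero forcing set if eventually all vertices become blue; in that case $\operatorname{pt}_+(G;S)$ is the number of time steps needed to color all vertices blue (so it is $0$ if $S=V(G)$), and otherwise $\operatorname{pt}_+(G;S)=\infty$. Define $\operatorname{th}_+(G;S)=|S|+\operatorname{pt}_+(G;S)$, and the PSD throttling number $\operatorname{th}_+(G)=\min\{\operatorname{th}_+(G;S): S \text{ is a PSD zero forcing set of } G\}$. *)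

(* Defs.v *)
From mathcomp Require Import all_boot.

Set Implicit Arguments.
Unset Strict Implicit.
Unset Printing Implicit Defensive.

Record sgraph := SGraph {
  vertex :> finType;
  adj : rel vertex;
  adj_sym : symmetric adj;
  adj_irrefl : irreflexive adj }.

Definition isomorphic (G H : sgraph) : Prop :=
  exists2 f : G -> H, bijective f & {mono f : x y / adj x y}.

Section StandardGraphs.

Definition bipartite_adj (m k : nat) : rel ('I_m + 'I_k)%type :=
  fun x y => match x, y with
             | inl _, inr _ | inr _, inl _ => true
             | _, _ => false
             end.

Lemma bipartite_adj_sym m k : symmetric (@bipartite_adj m k).
Proof. by case=> ? [?|?]. Qed.

Lemma bipartite_adj_irrefl m k : irreflexive (@bipartite_adj m k).
Proof. by case. Qed.

Definition complete_bipartite (m k : nat) : sgraph :=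
  SGraph (@bipartite_adj_sym m k) (@bipartite_adj_irrefl m k).

Definition edgeless_adj (m : nat) : rel 'I_m := fun _ _ => false.

Lemma edgeless_adj_sym m : symmetric (@edgeless_adj m).
Proof. by []. Qed.

Lemma edgeless_adj_irrefl m : irreflexive (@edgeless_adj m).
Proof. by []. Qed.

Definition edgeless (m : nat) : sgraph :=
  SGraph (@edgeless_adj_sym m) (@edgeless_adj_irrefl m).

End StandardGraphs.

Section PSDForcing.
Variable G : sgraph.
Implicit Types (B S W : {set G}) (v w x y : G).

Definition white_adj B : rel G :=
  fun x y => [&& x \notin B, y \notin B & adj x y].

(* The vertex sets W_1, ..., W_k of the connected components of G - B. *)
Definition white_components B : {set {set G}} :=
  equivalence_partition (connect (white_adj B)) (~: B).

(* w is the only white neighbour of v in the subgraph induced by W :|: B. *)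
Definition forces_in B W v w : bool :=
  [set x in W :|: B | (x \notin B) && adj v x] == [set w].

Definition psd_step B : {set G} :=
  B :|: [set w | [exists W in white_components B, (w \in W) &&
                    [exists v in B, forces_in B W v w]]].

Definition blue_after S (t : nat) : {set G} := iter t psd_step S.

Definition psd_forcing_set S : Prop := exists t, blue_after S t == [set: G].

Lemma sub_psd_step B : B \subset psd_step B.
Proof. exact: subsetUl. Qed.

Lemma psd_forcing_setP S :
  reflect (psd_forcing_set S) (blue_after S #|G| == [set: G]).
Proof.
apply: (iffP idP) => [full|[t /eqP full]]; first by exists #|G|.
have stable k j : blue_after S k.+1 = blue_after S k ->
    blue_after S (j + k) = blue_after S k.
  by move=> fixk; elim: j => // j IHj; rewrite addSn /= IHj.
have grow k : k <= #|blue_after S k| \/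
    exists2 i, i <= k & blue_after S i.+1 = blue_after S i.
  elim: k => [|k [lek|[i lei fixi]]]; first by left.
    have [fixk|neqk] := eqVneq (blue_after S k) (blue_after S k.+1).
      by right; exists k.
    left; apply: leq_ltn_trans lek (proper_card _).
    by rewrite properEneq neqk sub_psd_step.
  by right; exists i; first exact: leqW.
case: (grow #|G|) => [le|[i lei fixi]].
  by rewrite eqEcard subsetT cardsT.
rewrite -(subnK lei) stable // -full; case: (leqP i t) => [leit|ltti].
  by rewrite -(subnK leit) stable.
rewrite full -subTset -full -(subnK (ltnW ltti)).
elim: (i - t) => //= j IHj; exact: subset_trans IHj (sub_psd_step _).
Qed.

(* None stands for infinity. *)
Definition pt_plus S : option nat :=
  if psd_forcing_setP S is ReflectT forcing then Some (ex_minn forcing)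
  else None.

Definition th_plus_set S : option nat := omap (addn #|S|) (pt_plus S).

Lemma th_plus_attained :
  exists k, [exists S : {set G}, th_plus_set S == Some k].
Proof.
rewrite /th_plus_set /pt_plus.
suff: exists k, omap (addn #|[set: G]|) (pt_plus [set: G]) = Some k.
  by case=> k full; exists k; apply/existsP; exists [set: G]; apply/eqP.
rewrite /pt_plus; case: psd_forcing_setP => [forcing|[]]; last by exists 0.
by eexists.
Qed.

(* The minimum ranges over the S with finite th_plus_set S, that is, over the
   PSD zero forcing sets. *)
Definition th_plus : nat := ex_minn th_plus_attained.

End PSDForcing.

(* Main.v *)
Require Import Defs.
From mathcomp Require Import all_boot.

(** Whatever the graph of order at least two, throttling cannot do better than
    two: the empty set never forces anything, and a single vertex needs at least
    one step.  Since the initial set is nonempty, a cost of exactly two leaves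
    only two possibilities.

    With two blue vertices and no step, those vertices are the whole graph,
    which is then [2K_1] or [K_2 = K_{1,1}].

    With one blue vertex [c] and one step, every other vertex is forced by [c].
    Hence every other vertex is a neighbour of [c], and no two of them are
    adjacent: two adjacent ones would share a component of [G - c], where [c]
    would then have two white neighbours.  So [G] is a star centred at [c].
    Conversely, removing the centre of a star isolates every leaf, and the
    centre forces all of them at once.

    [psd_step1P] carries the second case; [th_plus_leP] reduces the throttling
    number to the existence of a set and a number of steps, so that no optimal
    propagation time ever has to be computed. *)

Set Implicit Arguments.
Unset Strict Implicit.
Unset Printing Implicit Defensive.

Section Throttling.
Variable G : sgraph.
Implicit Types (S : {set G}) (c : G).

(** Blue sets only grow, so it is harmless to count more steps than the
    propagation time: both minima, over the times and over the sets, merge into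
    a single existential. *)
Lemma th_plus_leP k :
  (exists S t, #|S| + t <= k /\ blue_after S t = [set: G]) <-> th_plus G <= k.
Proof.
rewrite /th_plus; case: ex_minnP => m /existsP[S0 /eqP S0m] min_m; split.
  case=> S [t [le_k full]]; apply: leq_trans le_k.
  have: exists2 p, p <= t & th_plus_set S = Some (#|S| + p).
    rewrite /th_plus_set /pt_plus; case: psd_forcing_setP => [forcing|[]].
      by case: ex_minnP => p _ min_p; exists p => //; apply/min_p/eqP.
    by exists t; apply/eqP.
  case=> p le_pt thS; apply: (@leq_trans (#|S| + p)); last by rewrite leq_add2l.
  by apply: min_m; apply/existsP; exists S; apply/eqP.
move: S0m; rewrite /th_plus_set /pt_plus; case: psd_forcing_setP => //= forcing.
by case: ex_minnP => p /eqP full _ [<-] le_k; exists S0, p.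
Qed.

Lemma blue_after0 t : blue_after (set0 : {set G}) t = set0.
Proof.
rewrite /blue_after; elim: t => //= t ->; apply/setP => w.
rewrite /psd_step set0U !inE; apply/negbTE/existsP => -[W /and3P[_ _]].
by case/existsP => v; rewrite inE.
Qed.

Lemma th_plus_ge2 : 2 <= #|G| -> 2 <= th_plus G.
Proof.
move=> G2; rewrite ltnNge; apply/negP => /th_plus_leP[S [t [le1 full]]].
have [S0|S_neq0] := eqVneq S set0.
  by move/(congr1 (fun A : {set G} => #|A|)): full G2;
    rewrite S0 blue_after0 cards0 cardsT => <-.
move: S_neq0 le1 full; rewrite -card_gt0 => S_gt0.
case: t => [|t]; last by rewrite addnS ltnS leqn0 addn_eq0 eqn0Ngt S_gt0.
by rewrite addn0 => S_le1 /= ST; move: S_le1; rewrite ST cardsT leqNgt G2.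
Qed.

End Throttling.

Definition star_center (G : sgraph) (c : G) : Prop :=
  forall x y : G, adj x y = (x == c) (+) (y == c).

Section Stars.
Variables (G : sgraph) (c : G).

(** A vertex of a star is joined to another leaf only through the centre, so
    that every leaf is a component by itself once the centre is removed. *)
Lemma star_connect (w y : G) :
  star_center c -> connect (white_adj [set c]) w y -> y = w.
Proof.
move=> star /connectP[[|z p] //= /andP[+ _] _].
by rewrite /white_adj !inE star => /and3P[/negbTE-> /negbTE->].
Qed.

(** The only possible forcing vertex is [c], so everything is decided by how the
    neighbours of [c] are spread over the components of [G - c]: finishing in one
    step means that each component consists of exactly one vertex, adjacent to
    [c]. *)
Lemma psd_step1P : psd_step [set c] = [set: G] <-> star_center c.
Proof.
split=> [full|star].
  (* Adjacent vertices other than [c] lie in one component, so the uniqueness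
     half of this claim will make them coincide. *)
  have forced w : w != c -> adj c w /\ forall z, z != c -> adj c z ->
      connect (white_adj [set c]) w z -> z = w.
    move=> w_c; have: w \in psd_step [set c] by rewrite full inE.
    rewrite /psd_step !inE (negbTE w_c) /= => /existsP[W /and3P[]].
    case/imsetP=> x _ -> wW /existsP[v /andP[/set1P-> /eqP only_w]].
    have: w \in [set w] by rewrite set11.
    rewrite -only_w !inE => /and3P[_ _ cw]; split=> // z z_c cz wz.
    apply/set1P; rewrite -only_w !inE (negbTE z_c) cz orbF !andbT /=.
    by move: wW; rewrite !inE => /andP[_ xw]; apply: connect_trans xw wz.
  have adjc x : adj c x = (x != c).
    have [->|/forced[]//] := eqVneq x c; exact: adj_irrefl.
  move=> x y; have [->|x_c] := eqVneq x c; first by rewrite adjc.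
  have [->|y_c] := eqVneq y c; first by rewrite adj_sym adjc x_c.
  apply/negbTE/negP => xy.
  have [_ /(_ y y_c)] := forced x x_c; rewrite adjc y_c => /(_ isT) eq_yx.
  have yx: y = x by apply/eq_yx/connect1; rewrite /white_adj !inE x_c y_c.
  by rewrite yx adj_irrefl in xy.
apply/setP => w; rewrite /psd_step !inE; have [->//|w_c] := eqVneq w c.
apply/existsP.
exists [set y in ~: [set c] | connect (white_adj [set c]) w y].
apply/and3P; split; first by apply: imset_f; rewrite !inE.
  by rewrite !inE w_c connect0.
apply/existsP; exists c; rewrite set11; apply/eqP/setP => x; rewrite !inE.
rewrite star eqxx addTb; have [->|x_c] := eqVneq x c.
  by rewrite andbF eq_sym (negbTE w_c).
rewrite /= orbF andbT; apply/idP/eqP => [|->]; last exact: connect0.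
exact: star_connect.
Qed.

End Stars.

Section Isomorphisms.
Variable G : sgraph.

Lemma isomorphic_sym (H : sgraph) : isomorphic H G -> isomorphic G H.
Proof.
case=> f [g fK gK] f_mono; exists g; first by exists f.
by move=> x y; rewrite -f_mono !gK.
Qed.

(** The converse map runs from the model star to [G], numbering the leaves by
    the enumeration of the complement of [c]; in this direction no default leaf
    has to be supplied, so the star with no leaf is covered as well. *)
Lemma iso_starP :
  isomorphic G (complete_bipartite 1 (#|G| - 1)) <-> exists c : G, star_center c.
Proof.
split=> [[f [g fK gK] f_mono]|[c star]].
  pose o : complete_bipartite 1 (#|G| - 1) := inl ord0.
  have f_center x : (x == g o) = if f x is inl _ then true else false.
    rewrite -(can_eq fK) gK; case: (f x) => [i|i] //.
    by rewrite (ord1 i) eqxx.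
  exists (g o) => x y; rewrite -f_mono !f_center.
  by case: (f x); case: (f y).
have cardC : #|G| - 1 = #|[set~ c]| by rewrite cardsC1 subn1.
pose h (u : complete_bipartite 1 (#|G| - 1)) : G :=
  match u with inl _ => c | inr i => enum_val (cast_ord cardC i) end.
have h_center u : (h u == c) = if u is inl _ then true else false.
  case: u => [i|i] /=; first exact: eqxx.
  apply/negbTE; have := enum_valP (cast_ord cardC i).
  by rewrite !inE.
have G_gt0 : 0 < #|G| by apply/card_gt0P; exists c.
apply: isomorphic_sym; exists h; last first.
  by move=> u v; rewrite star !h_center; case: u; case: v.
apply: inj_card_bij; last by rewrite card_sum !card_ord subnKC.
move=> u v h_uv; move: (h_center u); rewrite h_uv h_center.
case: u v h_uv => [i|i] [j|j] //=; first by rewrite (ord1 i) (ord1 j).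
by move/enum_val_inj/cast_ord_inj => ->.
Qed.

Lemma iso_edgelessP m :
  isomorphic G (edgeless m) <-> #|G| = m /\ forall x y : G, adj x y = false.
Proof.
split=> [[f f_bij f_mono]|[cardG no_edge]].
  split; first by rewrite (bij_eq_card f_bij) card_ord.
  by move=> x y; rewrite -f_mono.
exists (fun x : G => cast_ord cardG (enum_rank x)); last first.
  by move=> x y; rewrite no_edge.
apply: inj_card_bij => [x y|]; last by rewrite card_ord cardG.
by move/cast_ord_inj/enum_rank_inj.
Qed.

Lemma order2P :
  #|G| = 2 -> (exists c : G, star_center c) \/ forall x y : G, adj x y = false.
Proof.
rewrite -cardsT => /eqP/cards2P => -[a [b [a_b G_ab]]].
have ab x : x = a \/ x = b.
  by apply/set2P; rewrite -G_ab inE.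
have [adj_ab|] := boolP (adj a b).
  left; exists a => x y; case: (ab x) => ->; case: (ab y) => ->;
    rewrite ?eqxx ?adj_irrefl ?[b == a]eq_sym ?(negbTE a_b) //.
  by rewrite adj_sym adj_ab.
move/negbTE=> not_ab; right; move=> x y; case: (ab x) => ->; case: (ab y) => ->;
  by rewrite ?adj_irrefl // adj_sym.
Qed.

End Isomorphisms.

Theorem proposition5p2 (G : sgraph) (n : nat) (hn : 2 <= n) (hG : #|G| = n) :
  th_plus G = 2 <->
  isomorphic G (complete_bipartite 1 (n - 1)) \/ isomorphic G (edgeless 2).
Proof.
rewrite -{}hG in hn *; split=> [th2|shapes].
  have /th_plus_leP[S [t [le2 full]]] : th_plus G <= 2 by rewrite th2.
  case: t le2 full => [|t].
    rewrite addn0 => S_le2 /= ST; rewrite ST cardsT in S_le2.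
    have G2 : #|G| = 2 by apply/anti_leq; rewrite S_le2.
    by case: (order2P G2) => ?; [left; apply/iso_starP | right; apply/iso_edgelessP].
  case: (posnP #|S|) => [/eqP|S_gt0].
    rewrite cards_eq0 => /eqP-> _; rewrite blue_after0.
    by move/(congr1 (fun A : {set G} => #|A|)); rewrite cards0 cardsT => G0;
      rewrite -G0 in hn.
  rewrite addnS ltnS => le1.
  have S1 : #|S| == 1.
    by rewrite eqn_leq S_gt0 andbT; apply: leq_trans le1; apply: leq_addr.
  case/cards1P: S1 le1 => c ->; rewrite cards1 add1n ltnS leqn0 => /eqP->.
  by move/psd_step1P => star; left; apply/iso_starP; exists c.
apply/anti_leq; rewrite th_plus_ge2 // andbT.
apply/th_plus_leP; case: shapes => [/iso_starP[c /psd_step1P full]|/iso_edgelessP[G2 _]].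
  by exists [set c], 1; rewrite cards1.
by exists [set: G], 0; rewrite cardsT G2.
Qed.
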